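(* Let $B\in\mathbb{R}^{n\times n}$ be a symmetric, positive definite matrix with $\lambda_{\max}(B)\le L$ and $\lambda_{\min}(B)\ge\mu>0$, and let $A\in\mathbb{R}^{n\times n}$, $b,x^0\in\mathbb{R}^n$, and $m\in\mathbb{N}$ with $m\le n$ be given. Let the sequences $\{x_G^k\}_k$ and $\{x_R^k\}_k$ be generated by GMRES and by the conjugate residual method (CR) applied to the linear systems $A(x-x^0)=b$ and $B(x-x^0)=b$ with $x_G^0=x_R^0=x^0$, respectively. Suppose further that there are constants $C_1,C_2,C_3>0$ such that: (i) $\|A-B\|\le C_1\|b\|$; (ii) for each $k=0,\dots,m$, we have $\|\bar x_G^k-x_G^0\|\le C_2\|b\|$; (iii) $\kappa\big((\bar X_G^k)^\top\bar X_G^k\big)\le C_3$ for all $k=1,\dots,m$. There exists a constant $\epsilon_\sharp>0$ such that if $\|b\|\le\epsilon_\sharp$, then there is $C>0$ such that $$\|x_G^k-x_R^k\|\le C\|b\|^2,\qquad \|\bar x_G^k-\bar x_R^k\|\le C\|b\|^2,\qquad \|\tilde x_G^k-\tilde x_R^k\|\le C\|b\|^2\qquad\text{for all }0\le k\le m.$$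
   Context: $L$ and $\mu$ are given real constants, and $1/L$ is the step size of the gradient-type steps below. $\|\cdot\|$ is the Euclidean norm for vectors and the spectral norm for matrices; $\lambda_{\max},\lambda_{\min}$ ($\sigma_{\max},\sigma_{\min}$) denote largest and smallest eigenvalues (singular values); $\kappa(M)=\sigma_{\max}(M)/\sigma_{\min}(M)$ is the condition number of a matrix $M$ ($+\infty$ if $\sigma_{\min}(M)=0$). $\mathcal{K}^k(M,b)=\mathrm{span}\{b,Mb,\dots,M^{k-1}b\}$ is the $k$-th Krylov space, with $\mathcal{K}^0(M,b)=\{0\}$. GMRES iterates: $x_G^k$ is the minimizer of $\|A(x-x^0)-b\|^2$ over $x\in x^0+\mathcal{K}^k(A,b)$ (unique when $A$ is nonsingular). CR iterates: $x_R^k$ is the minimizer of $\|B(x-x^0)-b\|^2$ over $x\in x^0+\mathcal{K}^k(B,b)$. Further, $\bar x_G^k=x_G^k-\frac1L(A(x_G^k-x^0)-b)$, $\ \bar x_R^k=x_R^k-\frac1L(B(x_R^k-x^0)-b)$, $\tilde x_G^k=\bar x_G^k-\frac1L(A(\bar x_G^k-x^0)-b)$, $\ \tilde x_R^k=\bar x_R^k-\frac1L(B(\bar x_R^k-x^0)-b)$, $\bar X_G^k=[\bar x_G^0-x^0,\dots,\bar x_G^k-x^0]$. *)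

(* Defs.v *)
From HB Require Import structures.
From mathcomp Require Import all_boot all_order all_algebra.
From mathcomp Require Import all_classical all_reals.

Set Implicit Arguments.
Unset Strict Implicit.
Unset Printing Implicit Defensive.

Import Order.TTheory GRing.Theory Num.Theory.
Local Open Scope classical_set_scope.
Local Open Scope ring_scope.

Section Spectral.
Variables (R : realType) (n : nat).
Implicit Types (v : 'cV[R]_n) (M : 'M[R]_n).

(* The canonical norm of MathComp-Analysis on matrices is the sup norm. *)
Definition enorm v : R := Num.sqrt (\sum_(i < n) v i 0 ^+ 2).

Definition eigenvalues M : set R := [set a | eigenvalue M a].

(* For n > 0 and a matrix with only real eigenvalues, the set of eigenvalues is
   finite and nonempty, so that sup and inf are its maximum and minimum; the
   same remark applies to the singular values of any square matrix. *)
Definition lambda_max M : R := sup (eigenvalues M).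
Definition lambda_min M : R := inf (eigenvalues M).

Definition singular_values M : set R :=
  [set Num.sqrt a | a in eigenvalues (M^T *m M)].

Definition sigma_max M : R := sup (singular_values M).
Definition sigma_min M : R := inf (singular_values M).

Definition specnorm M : R := sigma_max M.

Definition kappa M : \bar R :=
  if sigma_min M == 0 then +oo%E else (sigma_max M / sigma_min M)%:E.

Definition positive_definite M : Prop :=
  forall v, v != 0 -> 0 < (v^T *m M *m v) 0 0.

End Spectral.

Section Krylov.
Variables (R : realType) (n : nat).
Implicit Types (M : 'M[R]_n) (b x : 'cV[R]_n).

Definition krylov M b (k : nat) : {vspace 'cV[R]_n} :=
  <<[seq M ^+ i *m b | i <- iota 0 k]>>%VS.

Definition residual M b x0 x : 'cV[R]_n := M *m (x - x0) - b.

Definition minres_iterate M b x0 (k : nat) x : Prop :=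
  x - x0 \in krylov M b k /\
  forall y, y - x0 \in krylov M b k ->
    enorm (residual M b x0 x) ^+ 2 <= enorm (residual M b x0 y) ^+ 2.

(* GMRES (for a general M) and CR (for M symmetric positive definite) minimize
   the same functional over the same affine spaces, so that this predicate
   describes the iterates of both methods. *)
Definition minres_sequence M b x0 (x : nat -> 'cV[R]_n) : Prop :=
  x 0%N = x0 /\ forall k, minres_iterate M b x0 k (x k).

Definition grad_step (L : R) M b x0 x : 'cV[R]_n :=
  x - L^-1 *: residual M b x0 x.

Definition step_matrix (L : R) M b x0 (x : nat -> 'cV[R]_n) (k : nat) :
    'M[R]_(n, k.+1) :=
  \matrix_(i < n, j < k.+1) (grad_step L M b x0 (x j) - x0) i 0.

End Krylov.

(* Main.v *)
Require Import Defs.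
From mathcomp Require Import all_boot all_order all_algebra.
From mathcomp Require Import all_classical all_reals.
From mathcomp Require Import ring lra.
Import Order.TTheory GRing.Theory Num.Theory.
Local Open Scope ring_scope.

(** Write beta for the norm of b.  Everything the methods compute in the
first m steps has size O(beta), and A and B differ by O(beta), so that a
relative error O(beta) in the data becomes an absolute error O(beta^2) in the
iterates.  What has to be excluded is that the Krylov spaces of A and B drift
apart, since power bases are badly conditioned; the condition number
hypothesis is exactly what rules this out.

The gradient-step displacements of the first k+1 iterates, the columns of the
step matrix, lie in the Krylov space of dimension k+1.  The first column is
b / L, hence of size beta / L, so a bound on the condition number of the Gram
matrix gives |X y| >= c beta |y| ([step_matrix_coercive]).  In particular
the columns form a basis of the (k+1)-st Krylov space of A.  Suppose that the
iterates agree up to O(beta^2) for all indices at most k.  Then the step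
matrices of the two methods agree up to O(beta^2), which for small beta is
negligible against c beta: the step matrix of CR is also injective and its
columns span the Krylov space of B.  Sending X_A y to X_B y moves vectors by a
relative amount O(beta^2) / (c beta) = O(beta), in either direction.

The iterates with index k+1 solve two least squares problems whose operators
and subspaces are O(beta)-close.  The Galerkin orthogonality of both residuals
shows that their distance is O(beta) times the size beta of the solutions
([minres_subspace_perturbation], [iterate_perturbation]).  This closes an
induction on k ([iterates_close]), and one and two further gradient steps
only enlarge the constant ([grad_step_close]).

The spectral hypotheses enter through the Rayleigh quotient bound
[rayleigh_ge]: the largest t for which S - t I is positive semidefinite is an
eigenvalue of S, because a nonsingular semidefinite form is coercive.  This
yields the norm bounds from the extreme eigenvalues of B, from the spectral
norm of A - B and from the condition number. *)

Set Implicit Arguments.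
Unset Strict Implicit.
Unset Printing Implicit Defensive.

(** * Euclidean inner product and norm *)

Section InnerProduct.
Variable R : realType.

Definition dot n (u v : 'cV[R]_n) : R := (u^T *m v) 0 0.

Lemma dotE n (u v : 'cV[R]_n) : dot u v = \sum_i u i 0 * v i 0.
Proof. by rewrite /dot mxE; apply: eq_bigr => i _; rewrite mxE. Qed.

Lemma dotC n (u v : 'cV[R]_n) : dot u v = dot v u.
Proof. by rewrite !dotE; apply: eq_bigr => i _; rewrite mulrC. Qed.

Lemma dotDr n (u v w : 'cV[R]_n) : dot u (v + w) = dot u v + dot u w.
Proof. by rewrite /dot mulmxDr mxE. Qed.

Lemma dotZr n (u v : 'cV[R]_n) a : dot u (a *: v) = a * dot u v.
Proof. by rewrite /dot -scalemxAr mxE. Qed.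

Lemma dotNr n (u v : 'cV[R]_n) : dot u (- v) = - dot u v.
Proof. by rewrite -scaleN1r dotZr mulN1r. Qed.

Lemma dotDl n (u v w : 'cV[R]_n) : dot (v + w) u = dot v u + dot w u.
Proof. by rewrite dotC dotDr !(dotC u). Qed.

Lemma dotZl n (u v : 'cV[R]_n) a : dot (a *: v) u = a * dot v u.
Proof. by rewrite dotC dotZr dotC. Qed.

Lemma dotNl n (u v : 'cV[R]_n) : dot (- v) u = - dot v u.
Proof. by rewrite dotC dotNr dotC. Qed.

Lemma dot_adjoint m n (M : 'M[R]_(m, n)) u v :
  dot (M *m u) v = dot u (M^T *m v).
Proof. by rewrite /dot trmx_mul mulmxA. Qed.

Lemma dot_ge0 n (v : 'cV[R]_n) : 0 <= dot v v.
Proof. by rewrite dotE; apply: sumr_ge0 => i _; rewrite -expr2 sqr_ge0. Qed.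

Lemma dot_eq0 n (v : 'cV[R]_n) : dot v v = 0 -> v = 0.
Proof.
rewrite dotE => /eqP; rewrite psumr_eq0; last first.
  by move=> i _; rewrite -expr2 sqr_ge0.
move=> /allP v0; apply/matrixP => i j; rewrite mxE (ord1 j).
by have := v0 i (mem_index_enum i); rewrite /= mulf_eq0 orbb => /eqP.
Qed.

Lemma dot_gt0 n (v : 'cV[R]_n) : v != 0 -> 0 < dot v v.
Proof.
by move=> v0; rewrite lt0r dot_ge0 andbT; apply: contra_neq v0 => /dot_eq0.
Qed.

Lemma sqr_coord_le n (v : 'cV[R]_n) i : v i 0 ^+ 2 <= dot v v.
Proof.
rewrite dotE (bigD1 i) //= expr2 lerDl; apply: sumr_ge0 => j _.
by rewrite -expr2 sqr_ge0.
Qed.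

(** Source of both the Cauchy-Schwarz inequality and, with a = 0, of the
first order optimality condition of a least squares problem. *)
Lemma discriminant_le0 (a b c : R) : 0 <= c ->
  (forall t, 0 <= a + 2 * t * b + t ^+ 2 * c) -> b ^+ 2 <= a * c.
Proof.
move=> c_ge0 H; have [c0|c0] := eqVneq c 0.
  rewrite c0 mulr0; have [->|b0] := eqVneq b 0; first by rewrite expr0n.
  (* the affine function of t takes the value -1 there *)
  have := H (- (a + 1) / (2 * b)); rewrite c0 mulr0 addr0.
  have -> : 2 * (- (a + 1) / (2 * b)) * b = - (a + 1) by field.
  by move=> ?; lra.
have c_gt0 : 0 < c by rewrite lt0r c0.
(* the minimizer of the parabola *)
have := H (- b / c).
have -> : a + 2 * (- b / c) * b + (- b / c) ^+ 2 * c = (a * c - b ^+ 2) / c.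
  by field.
by rewrite pmulr_lge0 ?invr_gt0// subr_ge0.
Qed.

Lemma psd_cauchy_schwarz n (T : 'M[R]_n) x y : T^T = T ->
  (forall v, 0 <= dot v (T *m v)) ->
  dot x (T *m y) ^+ 2 <= dot x (T *m x) * dot y (T *m y).
Proof.
move=> symT psdT; apply: discriminant_le0 => // t.
have := psdT (x + t *: y).
rewrite mulmxDr -scalemxAr !(dotDl, dotDr, dotZl, dotZr).
have -> : dot y (T *m x) = dot x (T *m y) by rewrite dotC dot_adjoint symT.
by congr (_ <= _); ring.
Qed.

Lemma cauchy_schwarz_sqr n (x y : 'cV[R]_n) : dot x y ^+ 2 <= dot x x * dot y y.
Proof.
have := @psd_cauchy_schwarz _ 1%:M x y; rewrite !mul1mx; apply.
  by rewrite trmx1.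
by move=> v; rewrite mul1mx dot_ge0.
Qed.

Lemma enormE n (v : 'cV[R]_n) : enorm v = Num.sqrt (dot v v).
Proof. by rewrite dotE; congr Num.sqrt; apply: eq_bigr => i _; rewrite expr2. Qed.

Lemma sqr_enorm n (v : 'cV[R]_n) : enorm v ^+ 2 = dot v v.
Proof. by rewrite enormE sqr_sqrtr ?dot_ge0. Qed.

Lemma enorm_ge0 n (v : 'cV[R]_n) : 0 <= enorm v.
Proof. exact: sqrtr_ge0. Qed.

Lemma enorm0 n : enorm (0 : 'cV[R]_n) = 0.
Proof. by rewrite enormE /dot mulmx0 mxE sqrtr0. Qed.

Lemma enorm_eq0 n (v : 'cV[R]_n) : enorm v = 0 -> v = 0.
Proof. by move=> v0; apply: dot_eq0; rewrite -sqr_enorm v0 expr0n. Qed.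

Lemma enorm_gt0 n (v : 'cV[R]_n) : v != 0 -> 0 < enorm v.
Proof.
by move=> v0; rewrite lt0r enorm_ge0 andbT; apply: contra_neq v0 => /enorm_eq0.
Qed.

Lemma enormZ n (v : 'cV[R]_n) a : enorm (a *: v) = `|a| * enorm v.
Proof.
by rewrite !enormE dotZl dotZr mulrA -expr2 sqrtrM ?sqr_ge0// sqrtr_sqr.
Qed.

Lemma enormN n (v : 'cV[R]_n) : enorm (- v) = enorm v.
Proof. by rewrite -scaleN1r enormZ normrN1 mul1r. Qed.

Lemma cauchy_schwarz n (u v : 'cV[R]_n) : dot u v <= enorm u * enorm v.
Proof.
rewrite (le_trans (ler_norm _))// -(ler_pXn2r (ltn0Sn 1)) ?nnegrE ?mulr_ge0 ?enorm_ge0//.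
by rewrite exprMn !sqr_enorm real_normK ?num_real// cauchy_schwarz_sqr.
Qed.

Lemma enormD n (u v : 'cV[R]_n) : enorm (u + v) <= enorm u + enorm v.
Proof.
rewrite -(ler_pXn2r (ltn0Sn 1)) ?nnegrE ?addr_ge0 ?enorm_ge0//.
rewrite sqr_enorm dotDl !dotDr (dotC v u) -!sqr_enorm.
by have := cauchy_schwarz u v; nra.
Qed.

Lemma enormB n (u v : 'cV[R]_n) : enorm (u - v) <= enorm u + enorm v.
Proof. by rewrite -(enormN v) enormD. Qed.

Lemma abs_coord_le n (v : 'cV[R]_n) i : `|v i 0| <= enorm v.
Proof.
rewrite -(ler_pXn2r (ltn0Sn 1)) ?nnegrE ?enorm_ge0//.
by rewrite real_normK ?num_real// sqr_enorm sqr_coord_le.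
Qed.

Lemma enorm_sum (I : Type) (r : seq I) n (F : I -> 'cV[R]_n) :
  enorm (\sum_(i <- r) F i) <= \sum_(i <- r) enorm (F i).
Proof.
elim/big_ind2: _ => [|x a y b xa yb|//]; first by rewrite enorm0.
by rewrite (le_trans (enormD _ _))// lerD.
Qed.

End InnerProduct.

(** * Eigenvalues of symmetric matrices *)

Section SymmetricEigenvalues.
Variable R : realType.

(** A crude bound by the sum of the absolute entries is enough, as only the finiteness
of K matters. *)
Lemma quadratic_form_bounded n (M : 'M[R]_n) :
  exists2 K, 0 < K & forall v, `|dot v (M *m v)| <= K * dot v v.
Proof.
exists (1 + \sum_i \sum_j `|M i j|).
  by rewrite ltr_pwDl// sumr_ge0// => i _; rewrite sumr_ge0.
move=> v; rewrite mulrDl mul1r ler_wpDl ?dot_ge0//.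
rewrite {1}dotE mulr_suml (le_trans (ler_norm_sum _ _ _))//.
apply: ler_sum => i _; rewrite mxE mulr_sumr mulr_suml.
rewrite (le_trans (ler_norm_sum _ _ _))//; apply: ler_sum => j _.
rewrite !normrM mulrCA; apply: ler_wpM2l => //.
rewrite -sqr_enorm expr2.
by apply: ler_pM => //; apply: abs_coord_le.
Qed.

Lemma eigenvalue_sym n (S : 'M[R]_n) a : S^T = S -> eigenvalue S a ->
  exists2 v : 'cV_n, S *m v = a *: v & v != 0.
Proof.
move=> symS /eigenvalueP [v vS v0]; exists v^T; last by rewrite trmx_eq0.
by rewrite -[in LHS]symS -trmx_mul vS linearZ.
Qed.

Lemma eigenvalue_unitmx n (S : 'M[R]_n) a :
  eigenvalue S a = (S - a%:M \notin unitmx).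
Proof. by rewrite /eigenvalue /eigenspace kermx_eq0 row_free_unit. Qed.

Lemma eigenvalues_bounded n (S : 'M[R]_n) : S^T = S ->
  exists K, forall a, eigenvalue S a -> `|a| <= K.
Proof.
move=> symS; have [K K0 SK] := quadratic_form_bounded S; exists K => a.
move=> /(eigenvalue_sym symS) [v Sv v0]; have := SK v.
by rewrite Sv dotZr normrM (ger0_norm (dot_ge0 v)) ler_pM2r ?dot_gt0.
Qed.

(** With w = T^-1 v the Cauchy-Schwarz inequality of the form T reads
|v|^4 <= (v, T v) (v, T^-1 v), and the last factor is at most K |v|^2. *)
Lemma psd_unit_coercive n (T : 'M[R]_n) : T^T = T ->
  (forall v, 0 <= dot v (T *m v)) -> T \in unitmx ->
  exists2 e, 0 < e & forall v, e * dot v v <= dot v (T *m v).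
Proof.
move=> symT psdT uT; have [K K0 TK] := quadratic_form_bounded (invmx T).
exists K^-1; first by rewrite invr_gt0.
move=> v; rewrite ler_pdivrMl//.
have [->|v0] := eqVneq v 0; first by rewrite /dot !mulmx0 mxE mulr0.
have := psd_cauchy_schwarz v (invmx T *m v) symT psdT.
rewrite mulKVmx// (dotC _ v) => cs.
have := le_trans (ler_norm _) (TK v); have := psdT v; have := dot_gt0 v0.
set q := dot v (T *m v); set p := dot v _ in cs *; set r := dot v _ in cs *.
move=> p0 q0 rK; rewrite -(ler_pM2r p0) -expr2 (le_trans cs)//.
by rewrite (mulrC K) -mulrA; apply: ler_wpM2l.
Qed.

(** The least value sup E of the Rayleigh quotient is an eigenvalue: otherwise
S - (sup E) I would be a nonsingular semidefinite form, hence coercive, and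
sup E could be increased. *)
Lemma rayleigh_ge n (S : 'M[R]_n) c : S^T = S ->
  (forall a, eigenvalue S a -> c <= a) ->
  forall v, c * dot v v <= dot v (S *m v).
Proof.
move=> symS cS v; have [->|v0] := eqVneq v 0; first by rewrite /dot !mulmx0 mxE mulr0.
have p0 := dot_gt0 v0.
pose E := [set t | forall x, t * dot x x <= dot x (S *m x)]%classic.
have [K K0 SK] := quadratic_form_bounded S.
have E0 : (E !=set0)%classic.
  by exists (- K) => x; have := SK x; rewrite ler_norml mulNr => /andP[].
have Eub : has_ubound E.
  by exists (dot v (S *m v) / dot v v) => t /(_ v); rewrite ler_pdivlMr.
have Esup : E (sup E).
  move=> x; have [->|x0] := eqVneq x 0; first by rewrite /dot !mulmx0 mxE mulr0.
  rewrite -ler_pdivlMr ?dot_gt0//; apply: ge_sup => // t /(_ x).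
  by rewrite ler_pdivlMr ?dot_gt0.
apply: (le_trans _ (Esup v)); rewrite ler_pM2r//; apply: cS.
have shift x a : dot x ((S - a%:M) *m x) = dot x (S *m x) - a * dot x x.
  by rewrite mulmxBl mul_scalar_mx dotDr dotNr dotZr.
rewrite eigenvalue_unitmx; apply/negP => uT.
have [||e e0 coercive] := psd_unit_coercive _ _ uT.
- by rewrite linearB /= tr_scalar_mx symS.
- by move=> x; rewrite shift subr_ge0.
have : E (sup E + e).
  by move=> x; have := coercive x; rewrite shift; nra.
by move=> /(ub_le_sup Eub); rewrite gerDl leNgt e0.
Qed.

Lemma rayleigh_le n (S : 'M[R]_n) c : S^T = S ->
  (forall a, eigenvalue S a -> a <= c) ->
  forall v, dot v (S *m v) <= c * dot v v.
Proof.
move=> symS cS v; have := @rayleigh_ge _ (- S) (- c) _ _ v.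
rewrite mulNmx dotNr mulNr lerN2; apply; first by rewrite linearN /= symS.
move=> a /eigenvalueP [u uS u0]; rewrite lerNl; apply: cS.
by apply/eigenvalueP; exists u; rewrite // scaleNr -uS mulmxN opprK.
Qed.


Lemma eigenvalue_le_lambda_max n (S : 'M[R]_n) a : S^T = S ->
  eigenvalue S a -> a <= lambda_max S.
Proof.
move=> symS Sa; have [K SK] := eigenvalues_bounded symS.
apply: ub_le_sup => //; exists K => t /SK; apply: le_trans; exact: ler_norm.
Qed.

Lemma lambda_min_le_eigenvalue n (S : 'M[R]_n) a : S^T = S ->
  eigenvalue S a -> lambda_min S <= a.
Proof.
move=> symS Sa; have [K SK] := eigenvalues_bounded symS.
by apply: ge_inf => //; exists (- K) => t /SK; rewrite ler_norml => /andP[].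
Qed.

(** The lower bound is the Rayleigh bound combined with the Cauchy-Schwarz
inequality.  For the upper one, the inequality of the form B is applied to the
pair (B v, v), which bounds |B v|^4 by (L |B v|^2) (L |v|^2). *)
Lemma sym_enorm_bounds n (B : 'M[R]_n) (L mu : R) v : B^T = B -> 0 <= mu ->
  lambda_max B <= L -> mu <= lambda_min B ->
  mu * enorm v <= enorm (B *m v) <= L * enorm v.
Proof.
move=> symB mu0 BL muB.
have [->|v0] := eqVneq v 0; first by rewrite mulmx0 enorm0 !mulr0 lexx.
have lo u : mu * dot u u <= dot u (B *m u).
  by apply: rayleigh_ge => // a /(lambda_min_le_eigenvalue symB); apply: le_trans.
have hi u : dot u (B *m u) <= L * dot u u.
  apply: rayleigh_le => // a /(eigenvalue_le_lambda_max symB) aL.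
  exact: le_trans aL BL.
have nv := enorm_gt0 v0.
have L0 : 0 <= L.
  rewrite -(pmulr_lge0 _ (dot_gt0 v0)) (le_trans _ (hi v))//.
  by rewrite (le_trans _ (lo v))// mulr_ge0 ?dot_ge0.
apply/andP; split.
  rewrite -(ler_pM2l nv) (le_trans _ (cauchy_schwarz _ _))// (le_trans _ (lo v))//.
  by rewrite -sqr_enorm expr2 mulrCA.
have psdB u : 0 <= dot u (B *m u) by rewrite (le_trans _ (lo u)) ?mulr_ge0 ?dot_ge0.
have := psd_cauchy_schwarz (B *m v) v symB psdB.
have := enorm_ge0 (B *m v); rewrite le_eqVlt => /orP [/eqP <-|w0].
  by rewrite mulr_ge0 ?enorm_ge0.
move=> cs; have {cs} : dot (B *m v) (B *m v) ^+ 2 <=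
    (L * dot (B *m v) (B *m v)) * (L * dot v v).
  by rewrite (le_trans cs)// ler_pM.
rewrite -!sqr_enorm; set p := enorm v in nv *; set q := enorm _ in w0 *.
have -> : L * q ^+ 2 * (L * p ^+ 2) = (L * p * q) ^+ 2 by ring.
have [p_ge0 q_ge0] := (ltW nv, ltW w0).
by rewrite ler_pXn2r ?nnegrE ?exprn_ge0 ?mulr_ge0// expr2 ler_pM2r.
Qed.

End SymmetricEigenvalues.

(** * Singular values, spectral norm and condition number *)

Section SingularValues.
Variable R : realType.

Lemma gram_sym m n (M : 'M[R]_(m, n)) : (M^T *m M)^T = M^T *m M.
Proof. by rewrite trmx_mul trmxK. Qed.

Lemma singular_values_ge0 n (M : 'M[R]_n) : lbound (singular_values M) 0.
Proof. by move=> _ [a _ <-]; apply: sqrtr_ge0. Qed.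

Lemma singular_values_ubound n (M : 'M[R]_n) : has_ubound (singular_values M).
Proof.
have [K MK] := eigenvalues_bounded (gram_sym M).
exists (Num.sqrt K) => _ [a /MK aK <-].
by rewrite ler_wsqrtr// (le_trans (ler_norm a)).
Qed.

Lemma singular_values_bounds n (M : 'M[R]_n) s : singular_values M s ->
  sigma_min M <= s <= sigma_max M.
Proof.
move=> Ms; apply/andP; split; last exact/ub_le_sup/Ms/singular_values_ubound.
apply: ge_inf => //; exists 0; exact: singular_values_ge0.
Qed.

Lemma sigma_min_ge0 n (M : 'M[R]_n) : 0 <= sigma_min M.
Proof.
rewrite /sigma_min; have [->|/set0P M0] := eqVneq (singular_values M) set0%classic.
  by rewrite inf0.
exact/lb_le_inf/singular_values_ge0.
Qed.

Lemma sigma_max_ge0 n (M : 'M[R]_n) : 0 <= sigma_max M.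
Proof.
rewrite /sigma_max; have [->|/set0P [s Ms]] := eqVneq (singular_values M) set0%classic.
  by rewrite sup0.
by rewrite (le_trans (singular_values_ge0 Ms))// (ub_le_sup (singular_values_ubound M)).
Qed.

Lemma specnorm_mul_le n (M : 'M[R]_n) v : enorm (M *m v) <= specnorm M * enorm v.
Proof.
have s0 := sigma_max_ge0 M.
rewrite -(ler_pXn2r (ltn0Sn 1)) ?nnegrE ?mulr_ge0 ?enorm_ge0//.
rewrite exprMn !sqr_enorm dot_adjoint mulmxA.
apply: rayleigh_le; first exact: gram_sym.
move=> a Ma; have [a0|a0] := leP 0 a; last by rewrite (le_trans (ltW a0)) ?sqr_ge0.
rewrite -(sqr_sqrtr a0) ler_pXn2r ?nnegrE ?sqrtr_ge0//.
by have /andP[] : sigma_min M <= Num.sqrt a <= sigma_max M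
  by apply: singular_values_bounds; exists a.
Qed.

(** A Gram matrix G is symmetric and semidefinite, so each of its eigenvalues a
is nonnegative and is the square root of the eigenvalue a^2 of G^T G. *)
Lemma gram_eigenvalue_bounds m n (X : 'M[R]_(m, n)) a :
  eigenvalue (X^T *m X) a ->
  sigma_min (X^T *m X) <= a <= sigma_max (X^T *m X).
Proof.
set G := X^T *m X => Ga; apply: singular_values_bounds.
have [w Gw w0] := eigenvalue_sym (gram_sym X) Ga.
have a0 : 0 <= a.
  rewrite -(pmulr_lge0 _ (dot_gt0 w0)) -dotZr -Gw -mulmxA -dot_adjoint.
  exact: dot_ge0.
exists (a ^+ 2); last by rewrite sqrtr_sqr ger0_norm.
move: Ga => /eigenvalueP [v vG v0]; apply/eigenvalueP; exists v => //.
by rewrite gram_sym mulmxA vG -scalemxAl vG scalerA expr2.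
Qed.

(** The largest eigenvalue of the Gram matrix is at least its diagonal entry
at j, the squared norm of the j-th column; the condition number transfers this
lower bound to the smallest eigenvalue. *)
Lemma gram_kappa_coercive m n (X : 'M[R]_(m, n)) C j :
  (kappa (X^T *m X) <= C%:E)%E ->
  forall y, dot (col j X) (col j X) * dot y y <= C * dot (X *m y) (X *m y).
Proof.
rewrite /kappa; case: ifPn => [//|smin0]; rewrite lee_fin.
have smin_gt0 : 0 < sigma_min (X^T *m X) by rewrite lt0r smin0 sigma_min_ge0.
rewrite ler_pdivrMr// => kC y.
have gram u : dot (X *m u) (X *m u) = dot u (X^T *m X *m u).
  by rewrite dot_adjoint mulmxA.
have lo : sigma_min (X^T *m X) * dot y y <= dot (X *m y) (X *m y).
  rewrite gram; apply: rayleigh_ge; first exact: gram_sym.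
  by move=> a /gram_eigenvalue_bounds /andP[].
have hi : dot (col j X) (col j X) <= sigma_max (X^T *m X).
  (* the Rayleigh quotient at the j-th basis vector *)
  rewrite colE gram -[leRHS]mulr1.
  have -> : 1 = dot (delta_mx j 0 : 'cV[R]_n) (delta_mx j 0) :> R.
    rewrite dotE (bigD1 j)//= mxE !eqxx mulr1 big1 ?addr0// => i ij.
    by rewrite mxE (negbTE ij) mul0r.
  apply: rayleigh_le; first exact: gram_sym.
  by move=> a /gram_eigenvalue_bounds /andP[].
have C0 : 0 <= C.
  by rewrite -(pmulr_lge0 _ smin_gt0) (le_trans _ kC)// sigma_max_ge0.
have y0 := dot_ge0 y.
rewrite (le_trans (ler_wpM2r y0 (le_trans hi kC)))// -mulrA.
by apply: ler_wpM2l.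
Qed.

End SingularValues.

(** * Krylov spaces and minimal residual iterates *)

Section MinimalResidual.
Variables (R : realType) (n : nat).
Implicit Types (M A B : 'M[R]_n) (b x u v w : 'cV[R]_n).

(** Galerkin condition: the squared residual along x + t w is a quadratic
polynomial in t that is minimal at 0. *)
Lemma minres_orthogonal M b x0 k x w : minres_iterate M b x0 k x ->
  w \in krylov M b k -> dot (residual M b x0 x) (M *m w) = 0.
Proof.
move=> [xK xmin] wK; apply/eqP; rewrite -sqrf_eq0; apply/eqP/le_anti.
rewrite sqr_ge0 andbT -(mul0r (dot (M *m w) (M *m w))).
apply: discriminant_le0 => [|t]; first exact: dot_ge0.
have yK : x + t *: w - x0 \in krylov M b k by rewrite addrAC memvD// memvZ.
have := xmin _ yK; rewrite !sqr_enorm -subr_ge0.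
have -> : residual M b x0 (x + t *: w) = residual M b x0 x + t *: (M *m w).
  by rewrite /residual addrAC mulmxDr -scalemxAr addrAC.
move: (residual M b x0 x) => r.
rewrite !(dotDl, dotDr, dotZl, dotZr) (dotC (M *m w) r).
by congr (_ <= _); ring.
Qed.

(** Comparison with the starting point, whose residual is - b. *)
Lemma enorm_residual_le M b x0 k x : minres_iterate M b x0 k x ->
  enorm (residual M b x0 x) <= enorm b.
Proof.
move=> [_ /(_ x0)]; rewrite subrr mem0v => /(_ isT).
by rewrite ler_pXn2r ?nnegrE ?enorm_ge0// /residual subrr mulmx0 sub0r enormN.
Qed.

Lemma krylov_power M b k i : (i < k)%N -> M ^+ i *m b \in krylov M b k.
Proof.
move=> ik; apply/memv_span/mapP; exists i => //.
by rewrite mem_iota add0n.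
Qed.

Lemma krylov_start M b k : b \in krylov M b k.+1.
Proof. by have := krylov_power M b (ltn0Sn k); rewrite expr0 mul1mx. Qed.

Lemma krylov_sub M b k l : (k <= l)%N -> (krylov M b k <= krylov M b l)%VS.
Proof.
move=> kl; apply/span_subvP => v /mapP [i].
rewrite mem_iota add0n => /= ik ->.
by apply/krylov_power/(leq_trans ik).
Qed.

Lemma krylov_mulmx M b k w : w \in krylov M b k -> M *m w \in krylov M b k.+1.
Proof.
set s := [seq M ^+ i *m b | i <- iota 0 k].
move=> ws; rewrite (@coord_span _ _ _ (in_tuple s) w ws) mulmx_sumr.
apply: memv_suml => i _; rewrite -scalemxAr memvZ//.
have ik : (i < k)%N by rewrite (leq_trans (ltn_ord i))// size_map size_iota.
rewrite (nth_map 0%N) ?size_iota// nth_iota// add0n mulmxA mulmxE -exprS.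
exact: krylov_power.
Qed.

Lemma dim_krylov M b k : (\dim (krylov M b k) <= k)%N.
Proof. by rewrite (leq_trans (dim_span _))// size_map size_iota. Qed.

Lemma krylov_grad_step L M b x0 j x : minres_iterate M b x0 j x ->
  grad_step L M b x0 x - x0 \in krylov M b j.+1.
Proof.
move=> [xK _]; rewrite /grad_step addrAC memvB//.
  exact: subvP (krylov_sub _ _ (leqnSn j)) _ xK.
by rewrite memvZ// memvB ?krylov_start ?krylov_mulmx.
Qed.

Lemma step_matrix_col (L : R) M b x0 (x : nat -> 'cV[R]_n) k j :
  col j (step_matrix L M b x0 x k) = grad_step L M b x0 (x j) - x0.
Proof. by apply/matrixP => i l; rewrite !mxE (ord1 l). Qed.

Lemma krylov_step_matrix L M b x0 (x : nat -> 'cV[R]_n) k j : minres_sequence M b x0 x ->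
  col j (step_matrix L M b x0 x k) \in krylov M b k.+1.
Proof.
move=> [_ xmin].
rewrite step_matrix_col; apply: subvP (krylov_sub _ _ _) _ (krylov_grad_step L (xmin j)).
exact: ltn_ord.
Qed.

Lemma span_injective_columns k (X : 'M[R]_(n, k)) (V : {vspace 'cV[R]_n}) :
  (forall j, col j X \in V) -> (\dim V <= k)%N ->
  (forall y : 'cV_k, X *m y = 0 -> y = 0) ->
  forall v, v \in V -> exists y : 'cV_k, v = X *m y.
Proof.
move=> XV dimV injX v vV; pose s := [tuple col j X | j < k].
have comb (c : 'I_k -> R) : \sum_i c i *: s`_i = X *m \col_i c i.
  apply/matrixP => p q; rewrite (ord1 q) summxE mxE; apply: eq_bigr => i _.
  by rewrite -tnth_nth tnth_mktuple !mxE mulrC.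
have spanV : <<s>>%VS = V.
  apply: span_basis; rewrite basisEfree size_tuple dimV andbT; apply/andP; split.
    apply/freeP => c; rewrite comb => /injX c0 i.
    by have := congr1 (fun y : 'cV[R]_k => y i 0) c0; rewrite !mxE.
  by apply/span_subvP => w /mapP [j _ ->]; apply: XV.
move: vV; rewrite -spanV => vs; exists (\col_i coord s i v).
by rewrite -comb -coord_span.
Qed.

Lemma mulmx_columns k (X : 'M[R]_(n, k)) (y : 'cV[R]_k) :
  X *m y = \sum_j y j 0 *: col j X.
Proof.
apply/matrixP => p q; rewrite (ord1 q) summxE mxE; apply: eq_bigr => i _.
by rewrite !mxE mulrC.
Qed.

Lemma mulmx_columns_mem k (X : 'M[R]_(n, k)) (V : {vspace 'cV[R]_n}) y :
  (forall j, col j X \in V) -> X *m y \in V.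
Proof.
by move=> XV; rewrite mulmx_columns; apply: memv_suml => j _; apply: memvZ.
Qed.

Lemma enorm_mulmx_columns k (E : 'M[R]_(n, k)) rho (y : 'cV[R]_k) :
  (forall j, enorm (col j E) <= rho) ->
  enorm (E *m y) <= k%:R * rho * enorm y.
Proof.
move=> Erho; rewrite mulmx_columns.
apply: le_trans (enorm_sum _ _) _.
have -> : k%:R * rho * enorm y = \sum_(j < k) enorm y * rho.
  by rewrite sumr_const card_ord -mulr_natl; ring.
apply: ler_sum => j _; rewrite enormZ.
by apply: ler_pM => //; [apply: enorm_ge0|apply: abs_coord_le].
Qed.

(** Stability of the least squares solution under a perturbation of both the
operator and the subspace.  Replace u by a nearby u' in V and put z = u' - v.
By the orthogonality of B v - b to B V,
|B z|^2 = (B u' - A u, B z) + (A u - b, B z),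
and by the orthogonality of A u - b to A U, the vector B z in the last term
may be replaced by B z - A z' for a z' in U close to z.  Both terms are then
small, of order (tau + delta) |b| |z|. *)
Lemma minres_subspace_perturbation A B b (U V : {vspace 'cV[R]_n}) u v
    (L mu delta tau : R) :
  0 < mu -> mu <= L -> 0 <= delta -> delta <= mu / 2 -> 0 <= tau ->
  (forall w, mu * enorm w <= enorm (B *m w) <= L * enorm w) ->
  (forall w, enorm ((A - B) *m w) <= delta * enorm w) ->
  enorm (A *m u - b) <= enorm b ->
  u \in U -> (forall w, w \in U -> dot (A *m u - b) (A *m w) = 0) ->
  v \in V -> (forall w, w \in V -> dot (B *m v - b) (B *m w) = 0) ->
  (forall w, w \in U -> exists2 w', w' \in V & enorm (w - w') <= tau * enorm w) ->
  (forall w, w \in V -> exists2 w', w' \in U & enorm (w - w') <= tau * enorm w) ->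
  mu ^+ 2 * enorm (u - v) <= (10 * L * tau + 5 * delta) * enorm b.
Proof.
move=> mu0 muL d0 dmu t0 Bbd ABd resu uU uorth vV vorth UV VU.
have hB w : enorm (B *m w) <= L * enorm w by have /andP[] := Bbd w.
have lB w : mu * enorm w <= enorm (B *m w) by have /andP[] := Bbd w.
have beta0 := enorm_ge0 b.
have a0 := enorm_ge0 u.
(* A inherits the coercivity constant mu / 2 from B *)
have abound : mu * enorm u <= 4 * enorm b.
  have Au : enorm (A *m u) <= 2 * enorm b.
    by rewrite -(subrK b (A *m u)); have := enormD (A *m u - b) b; lra.
  have := enormB (A *m u) ((A - B) *m u).
  rewrite -mulmxBl opprB addrC subrK.
  by have := lB u; have := ABd u; nra.
have [u' u'V uu'] := UV _ uU.
have zV : u' - v \in V by rewrite memvB.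
have [z' z'U zz'] := VU _ zV.
set z := u' - v in zV zz'.
have z0 := enorm_ge0 z.
have e1 : enorm (B *m u' - A *m u) <= (L * tau + delta) * enorm u.
  have -> : B *m u' - A *m u = - (B *m (u - u') + (A - B) *m u).
    rewrite mulmxBl mulmxBr; move: (B *m u) (B *m u') (A *m u) => p q r.
    by apply/matrixP => i j; rewrite !mxE; ring.
  rewrite enormN; have := enormD (B *m (u - u')) ((A - B) *m u).
  by have := hB (u - u'); have := ABd u; nra.
have e2 : enorm (B *m z - A *m z') <= (2 * L * tau + delta) * enorm z.
  have -> : B *m z - A *m z' = A *m (z - z') - (A - B) *m z.
    rewrite mulmxBl (mulmxBr A z z'); move: (B *m z) (A *m z') (A *m z) => p q r.
    by apply/matrixP => i j; rewrite !mxE; ring.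
  have Aw : enorm (A *m (z - z')) <= 2 * L * enorm (z - z').
    have := enormD ((A - B) *m (z - z')) (B *m (z - z')).
    rewrite -mulmxDl subrK; have := hB (z - z'); have := ABd (z - z').
    by have := enorm_ge0 (z - z'); nra.
  have := enormB (A *m (z - z')) ((A - B) *m z); have := ABd z; nra.
have key : enorm (B *m z) ^+ 2 <=
    enorm (B *m u' - A *m u) * enorm (B *m z) + enorm b * enorm (B *m z - A *m z').
  have -> : enorm (B *m z) ^+ 2 =
      dot (B *m u' - A *m u) (B *m z) + dot (A *m u - b) (B *m z - A *m z').
    rewrite sqr_enorm dotDr dotNr uorth// subr0 -dotDl addrA subrK.
    rewrite [X in dot X _](_ : _ = (B *m u' - b) - (B *m v - b)).
      by rewrite dotDl dotNl vorth// subr0.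
    by rewrite mulmxBr opprB addrA subrK.
  rewrite lerD ?cauchy_schwarz// (le_trans (cauchy_schwarz _ _))//.
  by rewrite ler_wpM2r ?enorm_ge0.
have Bz0 := enorm_ge0 (B *m z); have lz := lB z.
have Lt0 : 0 <= L * tau by rewrite mulr_ge0//; lra.
have Nb : mu * enorm (B *m z) <= (6 * (L * tau) + 5 * delta) * enorm b.
  move: Bz0; rewrite le_eqVlt => /orP [/eqP <-|N0].
    by rewrite mulr0 mulr_ge0//; lra.
  have s1 : mu * enorm (B *m u' - A *m u) <= (L * tau + delta) * (4 * enorm b).
    by nra.
  have s2 : mu * enorm (B *m z - A *m z') <= (2 * (L * tau) + delta) * enorm (B *m z).
    by nra.
  rewrite -(ler_pM2r N0); nra.
have := enormD (u - u') z; rewrite /z addrA subrK -/z => tri.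
have muz : mu ^+ 2 * enorm z <= (6 * (L * tau) + 5 * delta) * enorm b by nra.
have muu : mu ^+ 2 * enorm (u - u') <= 4 * (L * tau) * enorm b.
  have s1 : mu * enorm (u - u') <= 4 * (tau * enorm b) by nra.
  have s2 : 0 <= tau * enorm b by rewrite mulr_ge0.
  have s3 := ler_wpM2l (ltW mu0) s1; have s4 := ler_wpM2r s2 muL.
  by lra.
have : mu ^+ 2 * enorm (u - v) <= mu ^+ 2 * (enorm (u - u') + enorm z).
  by rewrite ler_wpM2l ?sqr_ge0.
nra.
Qed.

End MinimalResidual.

(** * Comparison of the two methods *)

Section Comparison.
Variables (R : realType) (n : nat).
Implicit Types (A B : 'M[R]_n) (b p q : 'cV[R]_n).

Lemma grad_step_perturbation A B b x0 p q (L delta : R) : 0 < L ->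
  (forall w, enorm (B *m w) <= L * enorm w) ->
  (forall w, enorm ((A - B) *m w) <= delta * enorm w) ->
  enorm (grad_step L A b x0 p - grad_step L B b x0 q) <=
    2 * enorm (p - q) + L^-1 * (delta * enorm (p - x0)).
Proof.
move=> L0 hB ABd.
have -> : grad_step L A b x0 p - grad_step L B b x0 q =
    (p - q) - L^-1 *: ((A - B) *m (p - x0) + B *m (p - q)).
  rewrite /grad_step /residual (_ : B *m (p - q) = B *m (p - x0) - B *m (q - x0)).
    rewrite mulmxBl; move: (A *m _) (B *m _) (B *m _) => r s t.
    by apply/matrixP => i j; rewrite !mxE; ring.
  by rewrite -mulmxBr opprB addrA subrK.
apply: le_trans (enormB _ _) _; rewrite enormZ.
have Li : 0 < L^-1 by rewrite invr_gt0.
have LLi : L^-1 * L = 1 by rewrite mulVf ?gt_eqF.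
rewrite gtr0_norm//.
have e : enorm ((A - B) *m (p - x0) + B *m (p - q)) <=
    delta * enorm (p - x0) + L * enorm (p - q).
  by apply: le_trans (enormD _ _) _; rewrite lerD.
have := ler_wpM2l (ltW Li) e; rewrite mulrDr mulrA [in X in _ <= _ + X]mulrA LLi mul1r.
lra.
Qed.

Lemma grad_step_start (L : R) A b x0 : grad_step L A b x0 x0 = x0 + L^-1 *: b.
Proof. by rewrite /grad_step /residual subrr mulmx0 sub0r scalerN opprK. Qed.

Lemma dot_mulmx_one_column (X : 'M[R]_(n, 1)) y :
  dot (X *m y) (X *m y) = dot (col 0 X) (col 0 X) * dot y y.
Proof.
rewrite [X *m y](_ : _ = y 0 0 *: col 0 X).
  by rewrite dotZl dotZr (dotE y) big_ord1; ring.
by apply/matrixP => i j; rewrite !mxE big_ord1 (ord1 j) mulrC.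
Qed.

(** For k = 0 the step matrix is the single column b / L, whose Gram matrix
has condition number 1; the constant 1 + C3 covers this case together with the
others. *)
Lemma step_matrix_coercive (L C3 : R) A b x0 (x : nat -> 'cV[R]_n) k :
  0 < L -> 0 < C3 -> x 0%N = x0 ->
  ((1 <= k)%N -> (kappa ((step_matrix L A b x0 x k)^T *m step_matrix L A b x0 x k)
      <= C3%:E)%E) ->
  forall y, enorm b * enorm y <=
    L * (1 + C3) * enorm (step_matrix L A b x0 x k *m y).
Proof.
move=> L0 C0 xx0 kX y; set X := step_matrix L A b x0 x k.
have cX : dot (col 0 X) (col 0 X) * dot y y <= (1 + C3) * dot (X *m y) (X *m y).
  have := dot_ge0 (X *m y).
  case: k y kX @X => [y _|k y kX] X Xy0.
    by rewrite -dot_mulmx_one_column; nra.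
  by rewrite (le_trans (gram_kappa_coercive 0 (kX isT) y))//; nra.
have C1 : 0 < 1 + C3 by lra.
have p0 := enorm_ge0 b; have q0 := enorm_ge0 y; have r0 := enorm_ge0 (X *m y).
(* 1 + C3 <= (1 + C3)^2 allows to avoid a square root *)
rewrite -(ler_pXn2r (ltn0Sn 1)) ?nnegrE ?mulr_ge0 ?(ltW L0) ?(ltW C1)//.
move: cX; rewrite step_matrix_col xx0 grad_step_start addrC addKr dotZl dotZr.
rewrite -!sqr_enorm => cX.
have := ler_wpM2l (sqr_ge0 L) cX.
rewrite [leLHS](_ : _ = (enorm b * enorm y) ^+ 2); last by field; rewrite gt_eqF.
move=> /le_trans; apply.
rewrite [leRHS](_ : _ = L ^+ 2 * ((1 + C3) ^+ 2 * enorm (X *m y) ^+ 2)); last by ring.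
rewrite ler_wpM2l ?sqr_ge0// ler_wpM2r ?sqr_ge0//.
by nra.
Qed.

(** The step matrices X and Y of the two methods differ by at most
(k+1) rho, half of the coercivity constant gamma of X.  Hence Y is coercive
with constant gamma / 2, the columns of X and Y are bases of the two Krylov
spaces, and exchanging X y and Y y moves vectors by a relative amount of at
most 2 (k+1) rho / gamma. *)
Lemma iterate_perturbation A B b x0 (xG xR : nat -> 'cV[R]_n) k
    (L mu delta gamma rho : R) :
  0 < mu -> mu <= L -> 0 <= delta -> delta <= mu / 2 -> 0 < gamma -> 0 <= rho ->
  k.+1%:R * rho <= gamma / 2 ->
  (forall w, mu * enorm w <= enorm (B *m w) <= L * enorm w) ->
  (forall w, enorm ((A - B) *m w) <= delta * enorm w) ->
  minres_sequence A b x0 xG -> minres_sequence B b x0 xR ->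
  (forall y, gamma * enorm y <= enorm (step_matrix L A b x0 xG k *m y)) ->
  (forall j, (j <= k)%N ->
     enorm (grad_step L A b x0 (xG j) - grad_step L B b x0 (xR j)) <= rho) ->
  mu ^+ 2 * enorm (xG k.+1 - xR k.+1) <=
    (10 * L * (2 * (k.+1%:R * rho) / gamma) + 5 * delta) * enorm b.
Proof.
move=> mu0 muL d0 dmu g0 r0 small Bbd ABd sG sR coer close.
set X := step_matrix L A b x0 xG k in coer.
pose Y := step_matrix L B b x0 xR k.
have diff y : enorm (X *m y - Y *m y) <= k.+1%:R * rho * enorm y.
  rewrite -mulmxBl; apply: enorm_mulmx_columns => j.
  rewrite linearB /= !step_matrix_col opprB addrA subrK.
  by apply: close; rewrite -ltnS ltn_ord.
have : 0 <= k.+1%:R * rho by rewrite mulr_ge0.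
move: (k.+1%:R * rho) small diff => s small diff s0.
have coerY y : gamma / 2 * enorm y <= enorm (Y *m y).
  have := enormD (X *m y - Y *m y) (Y *m y); rewrite subrK.
  move: (diff y) (coer y) (ler_wpM2r (enorm_ge0 y) small).
  move: (enorm y) (enorm (X *m y)) (enorm (Y *m y)) (enorm (_ - _)).
  by move=> ny nXy nYy nd; lra.
have inj (Z : 'M[R]_(n, k.+1)) (c : R) : 0 < c ->
    (forall y, c * enorm y <= enorm (Z *m y)) ->
    forall y : 'cV[R]_k.+1, Z *m y = 0 -> y = 0.
  move=> c0 cZ y Zy; apply: enorm_eq0; apply/le_anti; rewrite enorm_ge0 andbT.
  by have := cZ y; rewrite Zy enorm0 pmulr_rle0.
have spanG := span_injective_columns (X := X)
  (fun j => krylov_step_matrix L j sG) (dim_krylov A b k.+1) (inj _ _ g0 coer).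
have g20 : 0 < gamma / 2 by lra.
have spanR := span_injective_columns (X := Y)
  (fun j => krylov_step_matrix L j sR) (dim_krylov B b k.+1) (inj _ _ g20 coerY).
have tau_bound y w : gamma / 2 * enorm y <= enorm w ->
    s * enorm y <= 2 * s / gamma * enorm w.
  move=> yw; have -> : s * enorm y = 2 * s / gamma * (gamma / 2 * enorm y).
    by field; rewrite gt_eqF.
  by rewrite ler_wpM2l// divr_ge0 ?(ltW g0)// mulr_ge0.
have [xG0 mG] := sG; have [xR0 mR] := sR.
have -> : xG k.+1 - xR k.+1 = (xG k.+1 - x0) - (xR k.+1 - x0).
  by rewrite opprB addrA subrK.
apply: (@minres_subspace_perturbation _ _ A B b (krylov A b k.+1) (krylov B b k.+1)) => //.
- by rewrite divr_ge0 ?(ltW g0)// mulr_ge0.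
- exact: enorm_residual_le (mG k.+1).
- by case: (mG k.+1).
- by move=> w; apply: minres_orthogonal (mG k.+1).
- by case: (mR k.+1).
- by move=> w; apply: minres_orthogonal (mR k.+1).
- move=> w /spanG [y ->]; exists (Y *m y).
    by apply: mulmx_columns_mem => j; apply: krylov_step_matrix.
  apply: le_trans (diff y) _; apply: tau_bound.
  by apply: le_trans (coer y); rewrite ler_wpM2r ?enorm_ge0//; lra.
- move=> w /spanR [y ->]; exists (X *m y).
    by apply: mulmx_columns_mem => j; apply: krylov_step_matrix.
  rewrite -enormN opprB; apply: le_trans (diff y) _; exact: tau_bound.
Qed.

(** The form in which the hypotheses on A, B and the iterates are used.  The
coercivity of the k-th step matrix is what controls the iterate k+1, whence
the range k < m. *)
Record perturbed_pair (L mu C1 C3 : R) (m : nat) A B b x0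
    (xG xR : nat -> 'cV[R]_n) : Prop := PerturbedPair {
  pair_bounds : forall w, mu * enorm w <= enorm (B *m w) <= L * enorm w;
  pair_close : forall w, enorm ((A - B) *m w) <= C1 * enorm b * enorm w;
  pair_minresA : minres_sequence A b x0 xG;
  pair_minresB : minres_sequence B b x0 xR;
  pair_coercive : forall k, (k < m)%N -> forall y, enorm b * enorm y <=
    L * (1 + C3) * enorm (step_matrix L A b x0 xG k *m y)
}.

(** The residual is at most |b|, so |A (x - x0)| <= 2 |b|, and A is coercive
with constant mu / 2. *)
Lemma gmres_displacement_le L mu C1 C3 m A B b x0 (xG xR : nat -> 'cV[R]_n) k :
  0 < mu -> C1 * enorm b <= mu / 2 ->
  perturbed_pair L mu C1 C3 m A B b x0 xG xR ->
  enorm (xG k - x0) <= 4 / mu * enorm b.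
Proof.
move=> mu0 small [Bbd ABd [_ mG] _ _].
have res := enorm_residual_le (mG k); rewrite /residual in res.
set u := xG k - x0 in res *.
have Au : enorm (A *m u) <= 2 * enorm b.
  by have := enormD (A *m u - b) b; rewrite subrK; lra.
have Bu : enorm (B *m u) <= enorm (A *m u) + enorm ((A - B) *m u).
  by have := enormB (A *m u) ((A - B) *m u); rewrite -mulmxBl subKr.
have /andP [lB _] := Bbd u.
rewrite mulrAC ler_pdivlMr//.
have := ler_wpM2r (enorm_ge0 u) small; have := ABd u.
move: (enorm u) (enorm b) (enorm (A *m u)) (enorm (B *m u)) (enorm (_ *m u)) Au Bu lB.
by move=> nu nb nAu nBu nd Au Bu lB h1 h2; lra.
Qed.

Lemma grad_step_close L mu C1 C3 m A B b x0 (xG xR : nat -> 'cV[R]_n) p q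
    (D E : R) :
  0 < L -> 0 < C1 -> perturbed_pair L mu C1 C3 m A B b x0 xG xR ->
  enorm (p - q) <= D * enorm b ^+ 2 -> enorm (p - x0) <= E * enorm b ->
  enorm (grad_step L A b x0 p - grad_step L B b x0 q) <=
    (2 * D + L^-1 * (C1 * E)) * enorm b ^+ 2.
Proof.
move=> L0 hC1 [Bbd ABd _ _ _] pq px.
apply: le_trans (grad_step_perturbation _ _ _ _ L0 _ ABd) _.
  by move=> w; have /andP[] := Bbd w.
rewrite [leRHS](_ : _ = 2 * (D * enorm b ^+ 2) +
    L^-1 * (C1 * enorm b * (E * enorm b))); last by ring.
apply: lerD; first by rewrite ler_pM2l.
rewrite ler_pM2l ?invr_gt0// ler_wpM2l//.
by apply: mulr_ge0; [exact: ltW|exact: enorm_ge0].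
Qed.

(** Induction on the number of steps.  The constants are chosen before the
matrices: D1 bounds the gradient steps, T |b| is the relative distance tau of
the Krylov spaces, D' is the constant that results for the new iterate, and
|b| <= 1 / T is the smallness required in [iterate_perturbation]. *)
Lemma iterates_close (L mu C1 C3 : R) (m : nat) :
  0 < mu -> mu <= L -> 0 < C1 -> 0 < C3 ->
  forall K, (K <= m)%N ->
  exists2 eps : R, 0 < eps /\ C1 * eps <= mu / 2 & exists2 D : R, 0 < D &
  forall A B b x0 (xG xR : nat -> 'cV[R]_n), b != 0 ->
    perturbed_pair L mu C1 C3 m A B b x0 xG xR -> enorm b <= eps ->
    forall k, (k <= K)%N -> enorm (xG k - xR k) <= D * enorm b ^+ 2.
Proof.
move=> mu0 muL hC1 hC3; have L0 : 0 < L by exact: lt_le_trans muL.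
elim=> [_|K IH Km].
  exists (mu / (2 * C1)); first split.
  - by rewrite divr_gt0 ?mulr_gt0.
  - by rewrite le_eqVlt; apply/orP; left; apply/eqP; field; rewrite gt_eqF.
  exists 1 => // A B b x0 xG xR b0 pair _ k; rewrite leqn0 => /eqP ->.
  have [_ _ [-> _] [-> _] _] := pair.
  by rewrite subrr enorm0 mul1r sqr_ge0.
have [eps [eps0 epsC] [D D0 IHD]] := IH (ltnW Km).
pose D1 : R := 2 * D + L^-1 * (C1 * (4 / mu)).
have D10 : 0 < D1 by rewrite addr_gt0 ?mulr_gt0 ?invr_gt0.
pose c := L * (1 + C3).
have c0 : 0 < c by rewrite mulr_gt0//; lra.
pose T : R := 2 * (K.+1%:R * D1) * c.
have T0 : 0 < T by rewrite /T (pmulr_lgt0 _ c0) mulr_gt0// mulr_gt0.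
pose D' := (10 * L * T + 5 * C1) / mu ^+ 2.
have D'0 : 0 < D'.
  apply: divr_gt0; last exact: exprn_gt0.
  by apply: addr_gt0; apply: mulr_gt0 => //; apply: mulr_gt0.
exists (Num.min eps T^-1); first split.
- by rewrite lt_min eps0 invr_gt0.
- by apply: le_trans epsC; rewrite ler_pM2l// ge_min lexx.
exists (D + D'); first exact: addr_gt0.
move=> A B b x0 xG xR b0 pair; rewrite le_min => /andP [beps bT] k.
have IHk j (jK : (j <= K)%N) := IHD A B b x0 xG xR b0 pair beps j jK.
have nb := enorm_gt0 b0.
rewrite leq_eqVlt ltnS => /orP [/eqP ->|kK]; last first.
  by rewrite (le_trans (IHk k kK))// ler_wpM2r ?sqr_ge0// lerDl ltW.
have small : C1 * enorm b <= mu / 2.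
  by apply: le_trans epsC; rewrite ler_pM2l.
have [Bbd ABd sG sR coer] := pair.
have grad_close j : (j <= K)%N ->
    enorm (grad_step L A b x0 (xG j) - grad_step L B b x0 (xR j)) <= D1 * enorm b ^+ 2.
  move=> jK; apply: (grad_step_close L0 hC1 pair (IHk j jK)).
  exact: gmres_displacement_le pair.
have g0 : 0 < enorm b / c by rewrite divr_gt0.
have step : mu ^+ 2 * enorm (xG K.+1 - xR K.+1) <=
    (10 * L * (2 * (K.+1%:R * (D1 * enorm b ^+ 2)) / (enorm b / c))
     + 5 * (C1 * enorm b)) * enorm b.
  apply: iterate_perturbation Bbd ABd sG sR _ grad_close => //.
  - by rewrite mulr_ge0 ?enorm_ge0 ?ltW.
  - by rewrite mulr_ge0 ?sqr_ge0 ?ltW.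
  - rewrite [leLHS](_ : _ = enorm b / c / 2 * (T * enorm b)).
      rewrite ler_piMr ?(divr_ge0 (ltW g0))//.
      by rewrite -(mulfV (lt0r_neq0 T0)) ler_pM2l.
    by rewrite /T; field; rewrite gt_eqF.
  - by move=> y; rewrite mulrAC ler_pdivrMr// [leRHS]mulrC; apply: coer.
have D'step : (10 * L * (2 * (K.+1%:R * (D1 * enorm b ^+ 2)) / (enorm b / c))
    + 5 * (C1 * enorm b)) * enorm b = mu ^+ 2 * (D' * enorm b ^+ 2).
  by rewrite /D' /T; field; rewrite !gt_eqF.
move: step; rewrite D'step ler_pM2l ?exprn_gt0// => /le_trans; apply.
by rewrite ler_wpM2r ?sqr_ge0// lerDr ltW.
Qed.

Lemma minres_zero_rhs (M : 'M[R]_n) x0 (x : nat -> 'cV[R]_n) k :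
  minres_sequence M 0 x0 x -> x k = x0.
Proof.
move=> [_ /(_ k) [xK _]]; apply/subr0_eq; move: xK.
rewrite /krylov (_ : <<_>>%VS = 0%VS) ?memv0; first by move/eqP.
by apply/eqP; rewrite -subv0; apply/span_subvP => v /mapP [i _ ->]; rewrite mulmx0 mem0v.
Qed.

Lemma grad_step_zero_rhs (L : R) (M : 'M[R]_n) (x0 : 'cV[R]_n) : grad_step L M 0 x0 x0 = x0.
Proof. by rewrite grad_step_start scaler0 addr0. Qed.

End Comparison.

Theorem theorem3p12 (R : realType) (L mu : R) (n m : nat) (C1 C2 C3 : R)
    (hmu : 0 < mu) (hmn : (m <= n)%N)
    (hC1 : 0 < C1) (hC2 : 0 < C2) (hC3 : 0 < C3) :
  exists2 eps : R, 0 < eps & exists2 C : R, 0 < C &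
  forall (A B : 'M[R]_n) (b x0 : 'cV[R]_n) (xG xR : nat -> 'cV[R]_n),
    B^T = B -> positive_definite B ->
    lambda_max B <= L -> mu <= lambda_min B ->
    minres_sequence A b x0 xG ->
    minres_sequence B b x0 xR ->
    specnorm (A - B) <= C1 * enorm b ->
    (forall k, (k <= m)%N ->
       enorm (grad_step L A b x0 (xG k) - xG 0%N) <= C2 * enorm b) ->
    (forall k, (1 <= k <= m)%N ->
       (kappa ((step_matrix L A b x0 xG k)^T *m step_matrix L A b x0 xG k)
          <= C3%:E)%E) ->
    enorm b <= eps ->
    forall k, (k <= m)%N ->
      [/\ enorm (xG k - xR k) <= C * enorm b ^+ 2,
          enorm (grad_step L A b x0 (xG k) - grad_step L B b x0 (xR k))
            <= C * enorm b ^+ 2 &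
          enorm (grad_step L A b x0 (grad_step L A b x0 (xG k))
                 - grad_step L B b x0 (grad_step L B b x0 (xR k)))
            <= C * enorm b ^+ 2].
Proof.
have [Lmu|muL] := ltP L mu.
  (* then the space is trivial, as mu |v| <= |B v| <= L |v| for all v *)
  exists 1 => //; exists 1 => // A B b x0 xG xR symB _ BL Bmu mG mR _ _ _ _ k _.
  have b0 : b = 0.
    apply: enorm_eq0; apply/le_anti; rewrite enorm_ge0 andbT leNgt; apply/negP => nb.
    have /andP [lo hi] := sym_enorm_bounds b symB (ltW hmu) BL Bmu.
    by have := le_trans lo hi; rewrite ler_pM2r// leNgt Lmu.
  move: mG mR; rewrite b0 => mG mR.
  rewrite !(minres_zero_rhs _ mG) !(minres_zero_rhs _ mR) !grad_step_zero_rhs.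
  by rewrite subrr !enorm0 expr0n mulr0.
have L0 : 0 < L by apply: lt_le_trans muL.
have [eps [eps0 epsC] [D D0 close]] := iterates_close n hmu muL hC1 hC3 (leqnn m).
pose D1 : R := 2 * D + L^-1 * (C1 * (4 / mu)).
pose D2 : R := 2 * D1 + L^-1 * (C1 * C2).
have D10 : 0 < D1 by rewrite addr_gt0 ?mulr_gt0 ?invr_gt0.
have D20 : 0 < D2.
  by apply: addr_gt0; apply: mulr_gt0; rewrite ?invr_gt0 ?mulr_gt0.
exists eps => //; exists (D + D1 + D2); first by rewrite addr_gt0// addr_gt0.
move=> A B b x0 xG xR symB _ BL Bmu mG mR AB barG kX beps k km.
(* for b = 0 both methods stay at x0 *)
have [b0|b0] := eqVneq b 0.
  move: mG mR; rewrite b0 => mG mR.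
  rewrite !(minres_zero_rhs _ mG) !(minres_zero_rhs _ mR) !grad_step_zero_rhs.
  by rewrite subrr !enorm0 expr0n mulr0.
have [xG0 _] := mG.
have hB w := sym_enorm_bounds w symB (ltW hmu) BL Bmu.
have ABd w : enorm ((A - B) *m w) <= C1 * enorm b * enorm w.
  by rewrite (le_trans (specnorm_mul_le _ _))// ler_wpM2r ?enorm_ge0.
have pair : perturbed_pair L mu C1 C3 m A B b x0 xG xR.
  split=> // j jm; apply: step_matrix_coercive => // j1.
  by apply: kX; rewrite j1 ltnW.
have small : C1 * enorm b <= mu / 2 by apply: le_trans epsC; rewrite ler_pM2l.
have c1 := close A B b x0 xG xR b0 pair beps k km.
have c2 : enorm (grad_step L A b x0 (xG k) - grad_step L B b x0 (xR k)) <=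
    D1 * enorm b ^+ 2.
  apply: (grad_step_close L0 hC1 pair c1).
  exact: gmres_displacement_le pair.
have c3 : enorm (grad_step L A b x0 (grad_step L A b x0 (xG k))
    - grad_step L B b x0 (grad_step L B b x0 (xR k))) <= D2 * enorm b ^+ 2.
  by apply: (grad_step_close L0 hC1 pair c2); have := barG k km; rewrite xG0.
have weaken (d r : R) : r <= d * enorm b ^+ 2 -> d <= D + D1 + D2 ->
    r <= (D + D1 + D2) * enorm b ^+ 2.
  by move=> rd dD; apply: le_trans rd _; rewrite ler_wpM2r ?sqr_ge0.
split; [apply: weaken c1 _|apply: weaken c2 _|apply: weaken c3 _].
- by rewrite -addrA lerDl addr_ge0 ?ltW.
- by rewrite addrAC lerDr addr_ge0 ?ltW.
- by rewrite lerDr addr_ge0 ?ltW.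
Qed.
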